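(* Assume $\overline\sigma>\underline\sigma>0$. Then $\{\frac{d}{ds}\langle B\rangle_s\}_{s\in[0,T]}\notin M^1_G(0,T)$; that is, there is no $h\in M^1_G(0,T)$ with $\langle B\rangle_t=\int_0^t h_s\,ds$ for all $t\in[0,T]$.
   Context: **Sublinear expectations.** A sublinear expectation space $(\Omega,\mathcal H,\hat E)$ consists of a set $\Omega$, a vector lattice $\mathcal H$ of real functions on $\Omega$ containing the constants, and $\hat E:\mathcal H\to\mathbb R$ that is monotone, preserves constants, is sub-additive ($\hat E(X)-\hat E(Y)\le \hat E(X-Y)$) and positively homogeneous. $C_{l,Lip}(\mathbb R^n)$ is the set of continuous $\varphi$ with $|\varphi(x)-\varphi(y)|\le C(1+|x|^k+|y|^k)|x-y|$ for some $C,k$; $C_{b,Lip}$ is the set of bounded Lipschitz functions. Random vectors $X_1,X_2$ (possibly on different spaces) are identically distributed, $X_1\sim X_2$, if $\hat E_1[\varphi(X_1)]=\hat E_2[\varphi(X_2)]$ for all $\varphi\in C_{l,Lip}(\mathbb R^n)$. $Y$ is independent of $X$ if $\hat E[\varphi(X,Y)]=\hat E[\hat E[\varphi(x,Y)]_{x=X}]$ for all $\varphi\in C_{b,Lip}$. **$G$-expectation.** Fix $T>0$ and $G(a)=\frac12(\overline\sigma^2a^+-\underline\sigma^2a^-)$, $a\in\mathbb R$. A random variable $\xi$ is $G$-normal if $a\xi+b\hat\xi\sim\sqrt{a^2+b^2}\,\xi$ for all $a,b\ge0$, with $\hat\xi$ an independent copy of $\xi$, and $\frac12\hat E[a\xi^2]=G(a)$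 for all $a\in\mathbb R$. Let $\Omega_T=C_0([0,T];\mathbb R)$ (continuous paths starting at $0$, sup norm), $B$ the coordinate process, and $\mathcal H^0_T=\{\varphi(B_{t_1},\dots,B_{t_n}): n\ge1,\ t_i\in[0,T],\ \varphi\in C_{l,Lip}(\mathbb R^n)\}$. For $0=t_0<\dots<t_m\le T$ put $\hat E[\varphi(B_{t_1}-B_{t_0},\dots,B_{t_m}-B_{t_{m-1}})]=\tilde E[\varphi(\sqrt{t_1-t_0}\,\xi_1,\dots,\sqrt{t_m-t_{m-1}}\,\xi_m)]$, where the $\xi_i$ are $G$-normal on some sublinear expectation space with $\xi_{i+1}$ independent of $(\xi_1,\dots,\xi_i)$. $L^p_G(\Omega_T)$ ($p\ge1$) is the completion of $\mathcal H^0_T$ under $\|\xi\|_{p,G}=\hat E[|\xi|^p]^{1/p}$; $L^p_G(\Omega_t)$ is defined in the same way with time points in $[0,t]$. $\hat E$ extends continuously to $L^1_G(\Omega_T)$. **The space $M^1_G(0,T)$.** $L_{ip}(\Omega_t)=\{\varphi(B_{t_1},\dots,B_{t_n}): t_i\in[0,t],\ \varphi\in C_{b,Lip}(\mathbb R^n)\}$. $H^0_G(0,T)$ is the set of processes $\eta_t=\sum_{j=0}^{N-1}\xi_j1_{]t_j,t_{j+1}]}(t)$ with $0=t_0<\dots<t_N=T$ and $\xi_j\in L_{ip}(\Omega_{t_j})$. $M^1_G(0,T)$ is its completion under $\|\eta\|_{M^1_G}=\hat E\int_0^T|\eta_s|\,ds$. The map $\eta\mapsto\int_0^t\eta_s\,ds\in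 L^1_G(\Omega_t)$ extends continuously to $M^1_G(0,T)$. **Quadratic variation of $B$.** $\langle B\rangle_t$ is the $L^1_G$-limit of $\sum_k(B_{t_{k+1}}-B_{t_k})^2$ along partitions of $[0,t]$ with mesh tending to $0$; it satisfies $\underline\sigma^2(t-s)\le\langle B\rangle_t-\langle B\rangle_s\le\overline\sigma^2(t-s)$ for $s<t$, so its paths are absolutely continuous. *)

(* Defs.v *)
From HB Require Import structures.
From mathcomp Require Import all_boot all_order all_algebra.
From mathcomp Require Import all_classical all_reals all_analysis.

Set Implicit Arguments.
Unset Strict Implicit.
Unset Printing Implicit Defensive.

Import Order.TTheory GRing.Theory Num.Theory.
Import numFieldNormedType.Exports.

Local Open Scope classical_set_scope.
Local Open Scope ring_scope.

Section TestFunctions.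
Variables (R : realType) (n : nat).

(* `|x| is the max norm of 'rV[R]_n; both classes below are the same for any
   other norm on R^n. *)
Definition ClLip : set ('rV[R]_n -> R) :=
  [set phi | continuous phi /\
    exists (C : R) (k : nat), forall x y,
      `|phi x - phi y| <= C * (1 + `|x| ^+ k + `|y| ^+ k) * `|x - y|].

Definition CbLip : set ('rV[R]_n -> R) :=
  [set phi | (exists M : R, forall x, `|phi x| <= M) /\
             (exists L : R, forall x y, `|phi x - phi y| <= L * `|x - y|)].

End TestFunctions.

Section SublinearExpectation.
Variable R : realType.

Definition vector_lattice (Omega : Type) (H : set (Omega -> R)) : Prop :=
  [/\ forall c, H (fun=> c),
      forall X Y, H X -> H Y -> H (fun w => X w + Y w),
      forall c X, H X -> H (fun w => c * X w) &
      forall X Y, H X -> H Y -> H (fun w => Num.max (X w) (Y w))].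

(* E is a total function; only its values on H are meaningful. *)
Definition sublinear_expectation (Omega : Type) (H : set (Omega -> R))
    (E : (Omega -> R) -> R) : Prop :=
  [/\ forall X Y, H X -> H Y -> (forall w, Y w <= X w) -> E Y <= E X,
      forall c, E (fun=> c) = c,
      forall X Y, H X -> H Y -> E X - E Y <= E (fun w => X w - Y w) &
      forall c X, 0 <= c -> H X -> E (fun w => c * X w) = c * E X].

Record sublinear_space := SublinearSpace {
  outcome :> Type;
  rvars : set (outcome -> R);
  expect : (outcome -> R) -> R;
  rvars_lattice : vector_lattice rvars;
  expect_sublinear : sublinear_expectation rvars expect
}.

(* X is a random vector when E[phi(X)] makes sense for all phi in ClLip. *)
Definition random_vector (S : sublinear_space) n (X : S -> 'rV[R]_n) : Prop :=
  forall phi, ClLip phi -> rvars (fun w => phi (X w)).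

Definition ident_distr (S1 S2 : sublinear_space) n
    (X1 : S1 -> 'rV[R]_n) (X2 : S2 -> 'rV[R]_n) : Prop :=
  [/\ random_vector X1, random_vector X2 &
      forall phi, ClLip phi ->
        expect (fun w => phi (X1 w)) = expect (fun w => phi (X2 w))].

(* Y is independent of X; the order of the arguments matters. *)
Definition independent_of (S : sublinear_space) m n
    (Y : S -> 'rV[R]_n) (X : S -> 'rV[R]_m) : Prop :=
  random_vector (fun w => row_mx (X w) (Y w)) /\
  forall phi : 'rV[R]_(m + n) -> R, CbLip phi ->
    expect (fun w => phi (row_mx (X w) (Y w))) =
    expect (fun w => expect (fun w' => phi (row_mx (X w) (Y w')))).

Definition vec1 (Omega : Type) (X : Omega -> R) (w : Omega) : 'rV[R]_1 :=
  \row_(_ < 1) X w.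

End SublinearExpectation.

Section GExpectation.
Variable R : realType.

Definition Gfun (slo shi a : R) : R :=
  2^-1 * (shi ^+ 2 * Num.max a 0 - slo ^+ 2 * Num.max (- a) 0).

(* The space carrying xi need not be large enough to carry an independent copy
   of xi, so xi itself may be replaced by a copy xi1 on a larger space; the law
   of the pair (xi1, xi2) depends only on that of xi. *)
Definition G_normal (slo shi : R) (S : sublinear_space R) (xi : S -> R)
    : Prop :=
  (exists (S' : sublinear_space R) (xi1 xi2 : S' -> R),
    [/\ ident_distr (vec1 xi1) (vec1 xi),
        ident_distr (vec1 xi2) (vec1 xi),
        independent_of (vec1 xi2) (vec1 xi1) &
        forall a b : R, 0 <= a -> 0 <= b ->
          ident_distr (vec1 (fun w => a * xi1 w + b * xi2 w))
                      (vec1 (fun w => Num.sqrt (a ^+ 2 + b ^+ 2) * xi w))]) /\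
  forall a : R, 2^-1 * expect (fun w => a * xi w ^+ 2) = Gfun slo shi a.

(* Paths on [0, T] are represented by their extension by 0 to the real line,
   so that equality of elements of [cpath T] is equality on [0, T]. *)
Definition cpath (T : R) : Type :=
  {w : R -> R | [/\ w 0 = 0, {within `[0, T], continuous w} &
                    forall t, ~ (0 <= t <= T) -> w t = 0]}.

Definition B (T t : R) (w : cpath T) : R := sval w t.

(* cylinder variables with time points in [0, t] *)
Definition H0 (T t : R) : set (cpath T -> R) :=
  [set X | exists n (s : 'I_n -> R) (phi : 'rV[R]_n -> R),
    [/\ (0 < n)%N, forall i, 0 <= s i <= t, ClLip phi &
        X = fun w => phi (\row_i B (s i) w)]].

Definition Lip (T t : R) : set (cpath T -> R) :=
  [set X | exists n (s : 'I_n -> R) (phi : 'rV[R]_n -> R),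
    [/\ (0 < n)%N, forall i, 0 <= s i <= t, CbLip phi &
        X = fun w => phi (\row_i B (s i) w)]].

(* 0 = p 0 < p 1 < ... < p N = t; values p i with N < i are ignored *)
Definition partition_of (t : R) (N : nat) (p : nat -> R) : Prop :=
  [/\ p 0%N = 0, p N = t & forall i, (i < N)%N -> p i < p i.+1].

Definition mesh (N : nat) (p : nat -> R) : R :=
  \big[Num.max/0]_(i < N) (p i.+1 - p i).

Definition is_G_expectation (slo shi T : R) (E : (cpath T -> R) -> R) : Prop :=
  sublinear_expectation (H0 T) E /\
  exists (S : sublinear_space R) (xi : nat -> S -> R),
    [/\ forall i, G_normal slo shi (xi i),
        forall i, independent_of (vec1 (xi i.+1))
                                 (fun w => \row_(j < i.+1) xi j w) &
        forall (t : R) (m : nat) (p : nat -> R) (phi : 'rV[R]_m -> R),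
          (0 < m)%N -> t <= T -> partition_of t m p -> ClLip phi ->
          E (fun w => phi (\row_(i < m) (B (p i.+1) w - B (p i) w))) =
          expect (fun w => phi (\row_(i < m)
                                 (Num.sqrt (p i.+1 - p i) * xi i w)))].

End GExpectation.

(* The completion of the subspace D of V for the seminorm p, up to isometric
   isomorphism: a Banach space with a linear isometry from D onto a dense
   subspace. Elements at p-distance 0 are identified. The values of [embed]
   outside D are irrelevant. *)
Record completion (R : realType) (V : lmodType R) (D : set V) (p : V -> R) :=
  Completion {
    completed :> completeNormedModType R;
    embed : V -> completed;
    embed_linear : forall (a : R) (x y : V), D x -> D y ->
      embed (a *: x + y) = a *: embed x + embed y;
    embed_isometry : forall x, D x -> `|embed x| = p x;
    embed_dense : dense (embed @` D)
  }.

Definition continuous_extension (R : realType) (V W : lmodType R)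
    (D : set V) (p : V -> R) (D' : set W) (p' : W -> R)
    (M : completion D p) (L : completion D' p') (f : V -> W) (F : M -> L)
    : Prop :=
  continuous F /\ forall x, D x -> F (embed M x) = embed L (f x).

Section Spaces.
Variables (R : realType) (T : R) (E : (cpath T -> R) -> R).

Definition L1norm (X : cpath T -> R) : R := E (fun w => `|X w|).

Definition L1G_space : Type := @completion R (cpath T -> R^o) (H0 T) L1norm.

Definition H0G : set (R -> cpath T -> R) :=
  [set eta | exists (N : nat) (p : nat -> R) (xi : nat -> cpath T -> R),
    [/\ partition_of T N p,
        forall j, (j < N)%N -> Lip (p j) (xi j) &
        eta = fun s w => \sum_(j < N) xi j w * \1_(`]p j, p j.+1]) s]].

Definition integral_process (t : R) (eta : R -> cpath T -> R) (w : cpath T)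
    : R :=
  \int[lebesgue_measure]_(s in `[0, t]) eta s w.

Definition M1norm (eta : R -> cpath T -> R) : R :=
  E (integral_process T (fun s w => `|eta s w|)).

Definition M1G_space : Type := @completion R (R -> cpath T -> R^o) H0G M1norm.

Definition is_integral (L : L1G_space) (M : M1G_space) (I : R -> M -> L) : Prop :=
  forall t, 0 <= t <= T -> continuous_extension (integral_process t) (I t).

Definition is_quadratic_variation (L : L1G_space) (QV : R -> L) : Prop :=
  forall t, 0 <= t <= T ->
  forall (N : nat -> nat) (p : nat -> nat -> R),
    (forall n, partition_of t (N n) (p n)) ->
    mesh (N n) (p n) @[n --> \oo] --> (0 : R) ->
    embed L (fun w => \sum_(k < N n) (B (p n k.+1) w - B (p n k) w) ^+ 2)
      @[n --> \oo] --> QV t.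

End Spaces.

(* Main.v *)
Require Import Defs.
From HB Require Import structures.
From mathcomp Require Import all_boot all_order all_algebra.
From mathcomp Require Import all_classical all_reals all_analysis.
From mathcomp Require Import ring lra zify.
Import Order.TTheory GRing.Theory Num.Theory.
Import numFieldNormedType.Exports.
Local Open Scope classical_set_scope.
Local Open Scope ring_scope.

Set Implicit Arguments.
Unset Strict Implicit.
Unset Printing Implicit Defensive.

(** An element of M^1_G is close to a step process, and a step process cannot
    oscillate at a finer scale than its own partition. The derivative of the
    quadratic variation, by contrast, oscillates at every scale, because
    sublinear expectation lets the volatility be chosen anew, and adversely, on
    each time interval.

    Quantitatively, let [q] consist of the points of the partition of a step
    process [eta] and of the midpoints of its intervals, and consider
      Z = sum_i (-1)^i (<B>_{q_{i+1}} - <B>_{q_i}).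

    - On the first half of each interval the volatility can be [shi], on the
      second half [slo], so that Z has expectation T/2 (shi^2 - slo^2) and
      [`|Z|] is at least this number ([qv_incr_lower]). To see it, replace <B> by
      sums of squared increments of B along uniform refinements of [q]. The
      expectation of a signed sum of independent squares is the sum of the
      expectations ([expect_sqr_sum]), each of which is given by [Gfun].

    - If <B> were the integral process of [h], then Z would be the integral of
      the sign function sgn with values (-1)^i times [h]. The map from [h] to the
      integral of sgn h is 1-Lipschitz from M^1_G to L^1_G
      ([incr_integral_lip]), and it kills [eta], whose integrals over the two
      halves of each interval cancel ([overlap_midpoints]). Hence the norm of Z
      is at most the distance from [h] to [eta].

    Choosing [eta] closer to [h] than T/2 (shi^2 - slo^2) gives a
    contradiction. *)

(** * Test functions *)

Section MaxNorm.
Variable R : realType.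

Lemma mx_norm_le m n (A : 'M[R]_(m, n)) (e : R) :
  0 <= e -> (forall i j, `|A i j| <= e) -> `|A| <= e.
Proof.
by move=> e0 Ae; rewrite [leLHS]/Num.Def.normr/= mx_normrE bigmax_le// => -[i j].
Qed.

Lemma mx_norm_coord m n (A : 'M[R]_(m, n)) i j : `|A i j| <= `|A|.
Proof.
rewrite [leRHS]/Num.Def.normr/= mx_normrE.
by apply/bigmax_geP; right => /=; exists (i, j).
Qed.

Lemma norm_lsubmx m n (A : 'rV[R]_(m + n)) : `|lsubmx A| <= `|A|.
Proof. by apply: mx_norm_le => // i j; rewrite mxE mx_norm_coord. Qed.

Lemma norm_rsubmx m n (A : 'rV[R]_(m + n)) : `|rsubmx A| <= `|A|.
Proof. by apply: mx_norm_le => // i j; rewrite mxE mx_norm_coord. Qed.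

End MaxNorm.

Section PolynomialLipschitz.
Variable R : realType.

(** The weight [(1 + |x| + |y|) ^ k] is monotone in [k], which makes this form
    of the condition of [ClLip] convenient for sums and products. *)
Definition poly_lip n (phi : 'rV[R]_n -> R) : Prop :=
  exists (C : R) (k : nat), 0 <= C /\ forall x y,
    `|phi x - phi y| <= C * (1 + `|x| + `|y|) ^+ k * `|x - y|.

Lemma weight_ge1 n (x y : 'rV[R]_n) : 1 <= 1 + `|x| + `|y|.
Proof. by rewrite -addrA lerDl addr_ge0. Qed.

Lemma expr_sum_ge1 (k : nat) (a b : R) : 0 <= a -> 0 <= b ->
  (1 + a + b) ^+ k <= 3 ^+ k * (1 + a ^+ k + b ^+ k).
Proof.
move=> a0 b0; set m := Num.max 1 (Num.max a b).
have m1 : 1 <= m by rewrite le_max lexx.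
have ma : a <= m by rewrite !le_max lexx orbT.
have mb : b <= m by rewrite !le_max lexx !orbT.
apply: (@le_trans _ _ ((3 * m) ^+ k)).
  by apply: lerXn2r; rewrite ?nnegrE; lra.
rewrite exprMn ler_wpM2l ?exprn_ge0//.
have ak := exprn_ge0 k a0; have bk := exprn_ge0 k b0.
rewrite /m maxEle; case: ifP => _; last by rewrite expr1n; lra.
by rewrite maxEle; case: ifP => _; lra.
Qed.

Lemma nbhs_close n (x : 'rV[R]_n) (e : R) :
  0 < e -> \forall y \near x, `|x - y| <= e.
Proof.
move=> e0; apply/nbhs_ballP; exists e => //= y.
by rewrite mx_norm_ball => /ltW.
Qed.

Lemma poly_lip_continuous n (phi : 'rV[R]_n -> R) :
  poly_lip phi -> continuous phi.
Proof.
move=> [C [k [C0 H]]] x.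
have Fx : ProperFilter (nbhs x) by exact: nbhs_pfilter.
apply/(@cvgrPdist_le _ _ _ (nbhs x)) => e e0.
pose K := C * (2 + `|x| + `|x|) ^+ k + 1.
have K0 : 0 < K by rewrite ltr_wpDl// mulr_ge0// exprn_ge0// !addr_ge0.
have m0 : 0 < Num.min 1 (e / K) by rewrite lt_min ltr01 divr_gt0.
apply: filterS (nbhs_close x m0) => y; rewrite le_min => /andP[xy1 xye].
apply: le_trans (H x y) _.
apply: (@le_trans _ _ (K * `|x - y|)); last by rewrite mulrC -ler_pdivlMr.
rewrite ler_wpM2r//; apply: ler_wpDr => //; rewrite ler_wpM2l//.
apply: lerXn2r; rewrite ?nnegrE ?addr_ge0//.
have : `|y| <= `|x| + `|x - y|.
  by rewrite -[in leLHS](subrK x y) addrC distrC ler_normD.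
lra.
Qed.

Lemma ClLipP n (phi : 'rV[R]_n -> R) : ClLip phi <-> poly_lip phi.
Proof.
split=> [[_ [C [k H]]]|Hp].
  exists (`|C| * 3), k; split; first by rewrite mulr_ge0.
  move=> x y; apply: le_trans (H x y) _.
  rewrite ler_wpM2r//.
  have u1 := weight_ge1 x y.
  have h1 : 1 <= (1 + `|x| + `|y|) ^+ k by exact: exprn_ege1.
  have hx : `|x| ^+ k <= (1 + `|x| + `|y|) ^+ k.
    apply: lerXn2r; rewrite ?nnegrE//;
    by have hx' := normr_ge0 x; have hy' := normr_ge0 y; lra.
  have hy : `|y| ^+ k <= (1 + `|x| + `|y|) ^+ k.
    apply: lerXn2r; rewrite ?nnegrE//;
    by have hx' := normr_ge0 x; have hy' := normr_ge0 y; lra.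
  rewrite -mulrA; apply: (@le_trans _ _ (`|C| * (1 + `|x| ^+ k + `|y| ^+ k))).
    by rewrite ler_wpM2r ?ler_norm// !addr_ge0// exprn_ge0.
  by rewrite ler_wpM2l//; lra.
split; first exact: poly_lip_continuous.
have [C [k [C0 H]]] := Hp; exists (C * 3 ^+ k), k => x y.
apply: le_trans (H x y) _; rewrite ler_wpM2r// -mulrA ler_wpM2l//.
exact: expr_sum_ge1.
Qed.

Lemma CbLip_ClLip n (phi : 'rV[R]_n -> R) : CbLip phi -> ClLip phi.
Proof.
move=> [_ [C H]]; apply/ClLipP; exists `|C|, 0%N; split => // x y.
by rewrite expr0 mulr1; apply: le_trans (H x y) _; rewrite ler_wpM2r// ler_norm.
Qed.

Lemma poly_lip_coord n (i : 'I_n) : poly_lip (fun x : 'rV[R]_n => x 0 i).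
Proof.
exists 1, 0%N; split => // x y; rewrite expr0 !mul1r.
by apply: le_trans (mx_norm_coord (x - y) 0 i); rewrite !mxE.
Qed.

Lemma poly_lip_cst n c : poly_lip (fun _ : 'rV[R]_n => c).
Proof. by exists 0, 0%N; split => // x y; rewrite subrr normr0 !mul0r. Qed.

(** Lipschitz functions of two arguments cover sums, multiples and absolute
    values at once. *)
Definition lip2 (f : R -> R -> R) : Prop := exists2 K : R, 0 <= K &
  forall a b c d, `|f a b - f c d| <= K * (`|a - c| + `|b - d|).

Lemma poly_lip2 n (f : R -> R -> R) (phi psi : 'rV[R]_n -> R) :
  lip2 f -> poly_lip phi -> poly_lip psi ->
  poly_lip (fun x => f (phi x) (psi x)).
Proof.
move=> [K K0 Hf] [C1 [k1 [C10 H1]]] [C2 [k2 [C20 H2]]].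
exists (K * (C1 + C2)), (k1 + k2)%N; split.
  by rewrite mulr_ge0// addr_ge0.
move=> x y; apply: le_trans (Hf _ _ _ _) _.
rewrite -!mulrA ler_wpM2l// mulrDl; apply: lerD.
  apply: le_trans (H1 x y) _; rewrite -mulrA ler_wpM2l// ler_wpM2r//.
  by rewrite ler_weXn2l ?weight_ge1// leq_addr.
apply: le_trans (H2 x y) _; rewrite -mulrA ler_wpM2l// ler_wpM2r//.
by rewrite ler_weXn2l ?weight_ge1// leq_addl.
Qed.

Lemma poly_lip_growth n (phi : 'rV[R]_n -> R) : poly_lip phi ->
  exists (A : R) (k : nat), 0 <= A /\
    forall x y : 'rV[R]_n, `|phi x| <= A * (1 + `|x| + `|y|) ^+ k.
Proof.
move=> [C [k [C0 H]]]; exists (`|phi 0| + C), k.+1; split.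
  by rewrite addr_ge0.
move=> x y; have u1 := weight_ge1 x y.
have u0 : 0 <= 1 + `|x| + `|y| by lra.
have -> : phi x = phi 0 + (phi x - phi 0) by rewrite addrC subrK.
apply: le_trans (ler_normD _ _) _; rewrite mulrDl; apply: lerD.
  by rewrite ler_peMr//; exact: exprn_ege1.
apply: le_trans (H x 0) _; rewrite subr0 normr0 addr0 exprSr mulrA.
apply: ler_pM; rewrite ?mulr_ge0 ?exprn_ge0 ?addr_ge0//.
  by rewrite ler_wpM2l//; apply: lerXn2r; rewrite ?nnegrE ?addr_ge0// lerDl.
by have := normr_ge0 y; lra.
Qed.

(** Polynomial growth of one factor is absorbed by raising the exponent of the
    weight. *)
Lemma poly_lipM n (phi psi : 'rV[R]_n -> R) :
  poly_lip phi -> poly_lip psi -> poly_lip (fun x => phi x * psi x).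
Proof.
move=> Hphi Hpsi.
have [A1 [a1 [A10 G1]]] := poly_lip_growth Hphi.
have [A2 [a2 [A20 G2]]] := poly_lip_growth Hpsi.
case: Hphi => [C1 [k1 [C10 H1]]]; case: Hpsi => [C2 [k2 [C20 H2]]].
exists (A1 * C2 + A2 * C1), ((a1 + k2) + (a2 + k1))%N; split.
  by rewrite addr_ge0// mulr_ge0.
move=> x y; have u1 := weight_ge1 x y.
have u0 : 0 <= 1 + `|x| + `|y| by lra.
have -> : phi x * psi x - phi y * psi y =
    phi x * (psi x - psi y) + psi y * (phi x - phi y) by ring.
apply: le_trans (ler_normD _ _) _; rewrite !normrM -mulrA mulrDl; apply: lerD.
  apply: (@le_trans _ _ ((A1 * (1 + `|x| + `|y|) ^+ a1) *
      (C2 * (1 + `|x| + `|y|) ^+ k2 * `|x - y|))).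
    by apply: ler_pM.
  rewrite -!mulrA ler_wpM2l// mulrCA ler_wpM2l// !mulrA ler_wpM2r//.
  by rewrite -exprD ler_weXn2l// leq_addr.
apply: (@le_trans _ _ ((A2 * (1 + `|x| + `|y|) ^+ a2) *
    (C1 * (1 + `|x| + `|y|) ^+ k1 * `|x - y|))).
  apply: ler_pM => //.
  by have := G2 y x; rewrite -!addrA (addrC `|y|).
rewrite -!mulrA ler_wpM2l// mulrCA ler_wpM2l// !mulrA ler_wpM2r//.
by rewrite -exprD ler_weXn2l// leq_addl.
Qed.

Lemma poly_lip_comp m n (g : 'rV[R]_m -> 'rV[R]_n) (phi : 'rV[R]_n -> R) :
  (forall x, `|g x| <= `|x|) -> (forall x y, `|g x - g y| <= `|x - y|) ->
  poly_lip phi -> poly_lip (fun x => phi (g x)).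
Proof.
move=> g1 g2 [C [k [C0 H]]]; exists C, k; split => // x y.
apply: le_trans (H _ _) _.
have gx := g1 x; have gy := g1 y.
apply: ler_pM => //.
- by rewrite mulr_ge0// exprn_ge0// !addr_ge0.
- rewrite ler_wpM2l// lerXn2r ?nnegrE ?addr_ge0//.
  by rewrite !lerD.
Qed.

Lemma poly_lip_sum n (I : eqType) (r : seq I) (phi : I -> 'rV[R]_n -> R) :
  (forall i, i \in r -> poly_lip (phi i)) ->
  poly_lip (fun x => \sum_(i <- r) phi i x).
Proof.
elim: r => [_|i r IH H].
  by under eq_fun do rewrite big_nil; exact: poly_lip_cst.
under eq_fun do rewrite big_cons.
apply: (poly_lip2 (f := fun a b => a + b)).
- exists 1 => // a b c d; rewrite mul1r.
  by rewrite opprD addrACA ler_normD.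
- by apply: H; rewrite mem_head.
- by apply: IH => j jr; apply: H; rewrite in_cons jr orbT.
Qed.

Lemma CbLipB n (phi psi : 'rV[R]_n -> R) :
  CbLip phi -> CbLip psi -> CbLip (fun x => phi x - psi x).
Proof.
move=> [[M1 b1] [K1 l1]] [[M2 b2] [K2 l2]]; split.
  by exists (M1 + M2) => x; rewrite (le_trans (ler_normB _ _))// lerD.
exists (K1 + K2) => x y.
have -> : phi x - psi x - (phi y - psi y) =
    (phi x - phi y) - (psi x - psi y) by ring.
by rewrite (le_trans (ler_normB _ _))// mulrDl lerD.
Qed.

Lemma CbLip_comp m n (g : 'rV[R]_m -> 'rV[R]_n) (phi : 'rV[R]_n -> R) :
  (forall x y, `|g x - g y| <= `|x - y|) ->
  CbLip phi -> CbLip (fun x => phi (g x)).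
Proof.
move=> g1 [[M b] [K l]]; split; first by exists M => x.
exists `|K| => x y; apply: le_trans (l _ _) _.
by apply: (le_trans (ler_wpM2r (normr_ge0 _) (ler_norm K))); rewrite ler_wpM2l.
Qed.

End PolynomialLipschitz.

(** * Cylinder variables *)

Section Cylinders.
Variables (R : realType) (T : R).
Implicit Types (t : R) (X Y : cpath T -> R).

(** [H0] and [Lip] are the instances [F := ClLip] and [F := CbLip]. *)
Definition cylinder (F : forall n, set ('rV[R]_n -> R)) t : set (cpath T -> R) :=
  [set X | exists n (s : 'I_n -> R) (phi : 'rV[R]_n -> R),
    [/\ (0 < n)%N, forall i, 0 <= s i <= t, F n phi &
        X = fun w => phi (\row_i B (s i) w)]].

(** The two variables may use different time points; both become functions of
    the concatenated vector of time points. *)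
Lemma cylinder2 (F : forall n, set ('rV[R]_n -> R)) (f : R -> R -> R) t X Y :
  (forall m n phi psi, F m phi -> F n psi ->
     F (m + n)%N (fun z => f (phi (lsubmx z)) (psi (rsubmx z)))) ->
  cylinder F t X -> cylinder F t Y -> cylinder F t (fun w => f (X w) (Y w)).
Proof.
move=> Ff [m [s [phi [m0 sP Fphi ->]]]] [n [u [psi [n0 uP Fpsi ->]]]].
pose su (i : 'I_(m + n)) := match fintype.split i with inl j => s j | inr j => u j end.
exists (m + n)%N, su, (fun z => f (phi (lsubmx z)) (psi (rsubmx z))).
split; [by rewrite addn_gt0 m0| |exact: Ff|].
  by move=> i; rewrite /su; case: (fintype.split i).
apply/funext => w; congr (f (phi _) (psi _)); apply/rowP => i; rewrite !mxE /su.
  by rewrite (unsplitK (inl _ i)).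
by rewrite (unsplitK (inr _ i)).
Qed.

Lemma H0_lip2 (f : R -> R -> R) t X Y : lip2 f ->
  H0 t X -> H0 t Y -> H0 t (fun w => f (X w) (Y w)).
Proof.
move=> Hf; apply: (@cylinder2 (@ClLip R)) => m n phi psi /ClLipP h1 /ClLipP h2.
apply/ClLipP; apply: (poly_lip2 Hf).
- apply: poly_lip_comp h1 => [x|x y]; first exact: norm_lsubmx.
  by rewrite -linearB norm_lsubmx.
- apply: poly_lip_comp h2 => [x|x y]; first exact: norm_rsubmx.
  by rewrite -linearB norm_rsubmx.
Qed.

Lemma LipB t X Y : Lip t X -> Lip t Y -> Lip t (fun w => X w - Y w).
Proof.
apply: (@cylinder2 (@CbLip R) (fun a b => a - b)).
move=> m n phi psi h1 h2; apply: CbLipB.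
- apply: CbLip_comp h1 => x y; by rewrite -linearB norm_lsubmx.
- apply: CbLip_comp h2 => x y; by rewrite -linearB norm_rsubmx.
Qed.

Lemma Lip_le t u X : t <= u -> Lip t X -> Lip u X.
Proof.
move=> tu [n [s [phi [n0 sP Fphi ->]]]]; exists n, s, phi; split => // i.
by have /andP[-> /le_trans->] := sP i.
Qed.

Lemma Lip_H0 t u X : t <= u -> Lip t X -> H0 u X.
Proof.
move=> tu /(Lip_le tu)[n [s [phi [n0 sP Fphi ->]]]].
by exists n, s, phi; split => //; exact: CbLip_ClLip.
Qed.

End Cylinders.

(** * Sublinear expectations of sums of independent squares *)

Section Lattice.
Variables (R : realType) (Omega : Type) (H : set (Omega -> R)).
Variable (E : (Omega -> R) -> R).
Hypothesis HL : vector_lattice H.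
Hypothesis HE : sublinear_expectation H E.

Lemma lattice_sum (I : Type) (r : seq I) (X : I -> Omega -> R) :
  (forall i, H (X i)) -> H (fun w => \sum_(i <- r) X i w).
Proof.
case: HL => Hc Hadd _ _ HX; elim: r => [|i r IH].
  by under eq_fun do rewrite big_nil; exact: Hc.
by under eq_fun do rewrite big_cons; exact: Hadd.
Qed.

Lemma expect_addc X c : H X -> E (fun w => X w + c) = E X + c.
Proof.
case: HL HE => Hc Hadd _ _ [_ Ec Esub _] HX.
have HXc : H (fun w => X w + c) by exact: Hadd.
have h1 := Esub _ _ HXc HX; have h2 := Esub _ _ HX HXc.
have e1 : (fun w => X w + c - X w) = fun=> c by apply/funext => w; ring.
have e2 : (fun w => X w - (X w + c)) = fun=> - c by apply/funext => w; ring.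
move: h1 h2; rewrite e1 e2 !Ec => h1 h2; apply/eqP; rewrite eq_le.
by apply/andP; split; lra.
Qed.

(** The substitute for linearity used in all approximations. *)
Lemma expect_dist X Y Z : H X -> H Y -> H Z ->
  (forall w, `|X w - Y w| <= Z w) -> `|E X - E Y| <= E Z.
Proof.
case: HL HE => _ Hadd Hscale _ [Emono _ Esub _] HX HY HZ XYZ.
have HB U V : H U -> H V -> H (fun w => U w - V w).
  move=> HU HV; have := Hadd _ _ HU (Hscale (-1) _ HV).
  by under eq_fun do rewrite mulN1r.
rewrite ler_norml; apply/andP; split.
- rewrite lerNl opprB; apply: le_trans (Esub _ _ HY HX) _.
  apply: Emono => //; first exact: HB.
  by move=> w; apply: le_trans (XYZ w); rewrite distrC ler_norm.
- apply: le_trans (Esub _ _ HX HY) _; apply: Emono => //; first exact: HB.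
  by move=> w; apply: le_trans (XYZ w); rewrite ler_norm.
Qed.

End Lattice.

Section Truncation.
Variable R : realType.

(** A bounded Lipschitz truncation of [x ^+ 2]: independence is only known for
    bounded Lipschitz test functions. *)
Definition cut (m x : R) : R := Num.min `|x| m ^+ 2.

Lemma cut_bound (m x : R) : 0 <= m -> `|cut m x| <= m ^+ 2.
Proof.
move=> m0; rewrite /cut ger0_norm ?sqr_ge0//.
by rewrite lerXn2r ?nnegrE ?le_min ?normr_ge0// ge_min lexx orbT.
Qed.

Lemma dist_min (a b m : R) : `|Num.min a m - Num.min b m| <= `|a - b|.
Proof.
have h1 := ler_norm (a - b); have h2 := ler_norm (b - a).
rewrite distrC in h2; rewrite ler_norml !minEle.
by case: (leP a m) => ?; case: (leP b m) => ?; apply/andP; split; lra.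
Qed.

Lemma cut_lip (m x y : R) : 0 <= m -> `|cut m x - cut m y| <= 2 * m * `|x - y|.
Proof.
move=> m0; rewrite /cut subr_sqr normrM mulrC; apply: ler_pM => //.
  have h (z : R) : 0 <= Num.min `|z| m <= m.
    by rewrite le_min normr_ge0 m0 ge_min lexx orbT.
  have /andP[hx1 hx2] := h x; have /andP[hy1 hy2] := h y.
  by rewrite ger0_norm; lra.
by apply: le_trans (dist_min _ _ _) _; exact: ler_dist_dist.
Qed.

(** A bound by the fourth power makes the error of truncation controllable by
    moments. *)
Lemma cut_close (m x : R) : 0 < m -> `|x ^+ 2 - cut m x| <= m ^- 2 * x ^+ 4.
Proof.
move=> m0; rewrite /cut; have m20 : 0 < m ^+ 2 by rewrite exprn_gt0.
have x4 : 0 <= x ^+ 4 by rewrite (_ : x ^+ 4 = (x ^+ 2) ^+ 2) ?sqr_ge0// -exprM.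
have [xm|xm] := leP `|x| m.
  by rewrite real_normK ?num_real// subrr normr0 mulr_ge0// invr_ge0 ltW.
have mx2 : m ^+ 2 <= x ^+ 2.
  by rewrite -(real_normK (num_real x)) lerXn2r ?nnegrE// ltW.
rewrite ger0_norm ?subr_ge0// mulrC ler_pdivlMr//.
rewrite -[4%N]/(2 + 2)%N exprD.
by apply: ler_pM; rewrite ?subr_ge0 ?gerBl ?(ltW m20).
Qed.

Lemma CbLip_cut_sum n (m : R) (a : nat -> R) : 0 <= m ->
  CbLip (fun z : 'rV[R]_n => \sum_(k < n) a k * cut m (z 0 k)).
Proof.
move=> m0; split.
  exists (\sum_(k < n) `|a k| * m ^+ 2) => x.
  apply: le_trans (ler_norm_sum _ _ _) _; apply: ler_sum => k _.
  by rewrite normrM ler_wpM2l// cut_bound.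
exists (\sum_(k < n) `|a k| * (2 * m)) => x y.
rewrite -sumrB mulr_suml; apply: le_trans (ler_norm_sum _ _ _) _.
apply: ler_sum => k _; rewrite -mulrBr normrM -mulrA ler_wpM2l//.
apply: le_trans (cut_lip _ _ m0) _; rewrite ler_wpM2l ?mulr_ge0//.
by apply: le_trans (mx_norm_coord (x - y) 0 k); rewrite !mxE.
Qed.

End Truncation.

Section IndependentSquares.
Variables (R : realType) (S : sublinear_space R) (xi : nat -> S -> R).
Hypothesis xi_rv : forall i, random_vector (vec1 (xi i)).
Hypothesis xi_indep :
  forall i, independent_of (vec1 (xi i.+1)) (fun w => \row_(j < i.+1) xi j w).

Let HL := rvars_lattice S.
Let HE := expect_sublinear S.

Lemma rvars_pow i n c : rvars (fun w => c * xi i w ^+ n).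
Proof.
pose phi (z : 'rV[R]_1) := c * z 0 0 ^+ n.
have -> : (fun w => c * xi i w ^+ n) = (fun w => phi (vec1 (xi i) w)).
  by apply/funext => w; rewrite /phi mxE.
apply/xi_rv/ClLipP; apply: poly_lipM; first exact: poly_lip_cst.
elim: n {phi} => [|n IH]; first by under eq_fun do rewrite expr0; exact: poly_lip_cst.
by under eq_fun do rewrite exprS; apply: poly_lipM => //; exact: poly_lip_coord.
Qed.

Lemma rvars_cut i m c : 0 <= m -> rvars (fun w => c * cut m (xi i w)).
Proof.
move=> m0; pose phi (z : 'rV[R]_1) := \sum_(k < 1) c * cut m (z 0 k).
have -> : (fun w => c * cut m (xi i w)) = (fun w => phi (vec1 (xi i) w)).
  by apply/funext => w; rewrite /phi big_ord1 mxE.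
apply/xi_rv/CbLip_ClLip; exact: (@CbLip_cut_sum _ 1 m (fun=> c)).
Qed.

(** Conditionally on the first variables, the last term only shifts the
    expectation by a constant. *)
Lemma expect_cut_sum m (a : nat -> R) n : (0 : R) <= m ->
  expect (fun w => \sum_(k < n.+1) a k * cut m (xi k w)) =
  \sum_(k < n.+1) expect (fun w => a k * cut m (xi k w)).
Proof.
move=> m0; elim: n => [|n IH].
  by under eq_fun do rewrite big_ord1; rewrite big_ord1.
rewrite big_ord_recr/= -IH.
pose phi (z : 'rV[R]_(n.+1 + 1)) := \sum_(k < n.+1 + 1) a k * cut m (z 0 k).
pose X w := \row_(j < n.+1) xi j w.
pose head w := \sum_(k < n.+1) a k * cut m (xi k w).
have phiE w w' : phi (row_mx (X w) (vec1 (xi n.+1) w')) =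
    a n.+1 * cut m (xi n.+1 w') + head w.
  rewrite /phi big_split_ord/= big_ord1 row_mxEr mxE/= addn0 addrC; congr (_ + _).
  by apply: eq_bigr => k _; rewrite row_mxEl mxE.
have phi_lip : CbLip phi by exact: CbLip_cut_sum.
have head_rv : rvars head.
  by apply: (lattice_sum HL) => k; exact: rvars_cut.
have [_ /(_ _ phi_lip) indep] := xi_indep n.
transitivity (expect (fun w => phi (row_mx (X w) (vec1 (xi n.+1) w)))).
  congr expect; apply/funext => w.
  by rewrite phiE addrC /head [LHS]big_ord_recr.
rewrite indep -(expect_addc HL HE) //; congr expect; apply/funext => w.
rewrite addrC -(expect_addc HL HE); last exact: rvars_cut.
by congr expect; apply/funext => w'; rewrite phiE.
Qed.

Lemma eq0_of_le_inv_sqr (d K : R) :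
  (forall m, 0 < m -> `|d| <= m ^- 2 * K) -> d = 0.
Proof.
move=> H; have K0 : 0 <= K.
  by have := H 1 ltr01; rewrite expr1n invr1 mul1r; exact: le_trans.
apply/eqP; rewrite -normr_eq0 -[_ == 0]negbK; apply/negP => d0.
have dgt0 : 0 < `|d| by rewrite lt_def d0 /=.
have m1 : 1 <= K / `|d| + 1 by rewrite lerDr divr_ge0.
have := H _ (lt_le_trans ltr01 m1); apply/negP; rewrite -ltNge mulrC.
rewrite ltr_pdivrMr ?exprn_gt0// ?(lt_le_trans ltr01 m1)//.
apply: (@lt_le_trans _ _ (`|d| * (K / `|d| + 1))).
  by rewrite mulrDr mulr1 mulrCA divff// mulr1 ltrDl.
by rewrite ler_wpM2l// expr2 ler_peMr// (le_trans ler01).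
Qed.

(** The truncation error is uniformly small because fourth moments, being
    values of the expectation, are finite. *)
Lemma expect_sqr_sum (a : nat -> R) n :
  expect (fun w => \sum_(k < n) a k * xi k w ^+ 2) =
  \sum_(k < n) expect (fun w => a k * xi k w ^+ 2).
Proof.
case: n => [|n].
  under eq_fun do rewrite big_ord0; rewrite big_ord0.
  by case: HE => _ -> _ _.
have Hsq c i := rvars_pow i 2 c; have H4 c i := rvars_pow i 4 c.
pose W w := \sum_(k < n.+1) `|a k| * xi k w ^+ 4.
have HW : rvars W by exact: (lattice_sum HL).
have [_ _ Hscale _] := HL; have [_ _ _ Epos] := HE.
pose K := expect W + \sum_(k < n.+1) expect (fun w => `|a k| * xi k w ^+ 4).
apply/eqP; rewrite -subr_eq0; apply/eqP.
apply: (@eq0_of_le_inv_sqr _ K) => m m0.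
have m0' := ltW m0; have mi0 : 0 <= m ^- 2 by rewrite invr_ge0 exprn_ge0.
have close k w : `|a k * xi k w ^+ 2 - a k * cut m (xi k w)| <=
    m ^- 2 * (`|a k| * xi k w ^+ 4).
  by rewrite -mulrBr normrM mulrCA ler_wpM2l// cut_close.
have total : `|expect (fun w => \sum_(k < n.+1) a k * xi k w ^+ 2) -
    expect (fun w => \sum_(k < n.+1) a k * cut m (xi k w))| <= m ^- 2 * expect W.
  rewrite -Epos//; apply: (expect_dist HL HE).
  - exact: (lattice_sum HL).
  - by apply: (lattice_sum HL) => k; exact: rvars_cut.
  - exact: Hscale.
  - move=> w; rewrite -sumrB mulr_sumr; apply: le_trans (ler_norm_sum _ _ _) _.
    by apply: ler_sum.
have each (k : 'I_n.+1) : `|expect (fun w => a k * cut m (xi k w)) -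
    expect (fun w => a k * xi k w ^+ 2)| <=
    m ^- 2 * expect (fun w => `|a k| * xi k w ^+ 4).
  rewrite -Epos// distrC; apply: (expect_dist HL HE) => //.
  - exact: rvars_cut.
  - exact: Hscale.
rewrite mulrDr mulr_sumr.
(* compare through the truncated sum, where the expectation is additive *)
rewrite -(subrKA (expect (fun w => \sum_(k < n.+1) a k * cut m (xi k w)))).
apply: le_trans (ler_normD _ _) _; apply: lerD => //.
rewrite expect_cut_sum// -sumrB; apply: le_trans (ler_norm_sum _ _ _) _.
exact: ler_sum.
Qed.

End IndependentSquares.

Lemma G_normal_rv (R : realType) (slo shi : R) (S : sublinear_space R)
  (xi : S -> R) : G_normal slo shi xi -> random_vector (vec1 xi).
Proof. by move=> [[S' [xi1 [xi2 [[]]]]]]. Qed.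

Lemma expect_quadratic (R : realType) (slo shi : R) (S : sublinear_space R)
    (xi : nat -> S -> R) (a : nat -> R) n :
  (forall i, G_normal slo shi (xi i)) ->
  (forall i, independent_of (vec1 (xi i.+1)) (fun w => \row_(j < i.+1) xi j w)) ->
  expect (fun w => \sum_(k < n) a k * xi k w ^+ 2) =
  \sum_(k < n) 2 * Gfun slo shi (a k).
Proof.
move=> xiG xiI; rewrite expect_sqr_sum//; last by move=> i; exact: G_normal_rv.
apply: eq_bigr => k _; have [_ /(_ (a k)) <-] := xiG k.
by rewrite mulrA divff ?mul1r.
Qed.

(** * Partitions and step functions *)

Section Partitions.
Variable R : realType.
Implicit Types (p rho : nat -> R) (t s : R) (N K : nat).

Lemma part_le t N p i j : partition_of t N p ->
  (i <= j <= N)%N -> p i <= p j.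
Proof.
move=> [_ _ p_incr] /andP[]; elim: j => [|j IH].
  by rewrite leqn0 => /eqP->.
rewrite leq_eqVlt => /predU1P[-> //|ij] jN.
by apply: le_trans (IH ij (ltnW jN)) _; rewrite ltW// p_incr.
Qed.

Lemma part_ge0 t N p i : partition_of t N p -> (i <= N)%N -> 0 <= p i.
Proof. by move=> Pp iN; have [<- _ _] := Pp; exact: part_le Pp _. Qed.

Lemma part_le_end t N p i : partition_of t N p -> (i <= N)%N -> p i <= t.
Proof.
by move=> Pp iN; have [_ <- _] := Pp; apply: (part_le Pp); rewrite iN /=.
Qed.

Lemma find_oc p N s : p 0%N < s <= p N ->
  exists2 j, (j < N)%N & p j < s <= p j.+1.
Proof.
elim: N => [|N IH] /andP[s0 sN]; first by have := lt_le_trans s0 sN; rewrite ltxx.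
have [sp|sp] := leP s (p N); last by exists N => //; rewrite sp.
by have [|j jN H] := IH; [rewrite s0|exists j => //; exact: ltnW].
Qed.

Lemma find_co p N s : p 0%N <= s < p N ->
  exists2 j, (j < N)%N & p j <= s < p j.+1.
Proof.
elim: N => [|N IH] /andP[s0 sN]; first by have := le_lt_trans s0 sN; rewrite ltxx.
have [sp|sp] := leP (p N) s; first by exists N => //; rewrite sp.
by have [|j jN H] := IH; [rewrite s0|exists j => //; exact: ltnW].
Qed.

Definition stepf N p (c : nat -> R) (s : R) : R :=
  \sum_(j < N) c j * \1_(`]p j, p j.+1]) s.

Lemma indic_oc (a b s : R) : \1_(`]a, b]) s = ((a < s <= b)%R)%:R :> R.
Proof. by rewrite indicE mem_setE in_itv. Qed.

Lemma stepf_at t N p c s j : partition_of t N p -> (j < N)%N ->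
  p j < s <= p j.+1 -> stepf N p c s = c j.
Proof.
move=> Pp jN /andP[js sj]; rewrite /stepf (bigD1 (Ordinal jN))//= big1.
  by rewrite indic_oc js sj mulr1 addr0.
move=> i; rewrite -val_eqE/= indic_oc => ij.
case: andP => [[is_ si]|]; last by rewrite mulr0.
have [ij'|ij'] := ltnP i j.
  have := le_lt_trans (part_le Pp (_ : i.+1 <= j <= N)%N) js.
  by rewrite ltNge si ij' ltnW// => /(_ isT).
have {}ij' : (j < i)%N by rewrite ltn_neqAle eq_sym ij.
have := le_lt_trans (part_le Pp (_ : j.+1 <= i <= N)%N) is_.
by rewrite ltNge sj ij' ltnW// => /(_ isT).
Qed.

Lemma stepf_out t N p c s : partition_of t N p -> ~~ (0 < s <= t) ->
  stepf N p c s = 0.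
Proof.
move=> Pp st; rewrite /stepf big1// => i _; rewrite indic_oc.
case: andP => [[is_ si]|]; last by rewrite mulr0.
case/negP: st; rewrite (le_lt_trans (part_ge0 Pp (ltnW (ltn_ord i))) is_)/=.
exact: le_trans si (part_le_end Pp (ltn_ord i)).
Qed.

Lemma stepf_norm t N p c s : partition_of t N p ->
  `|stepf N p c s| = stepf N p (fun j => `|c j|) s.
Proof.
move=> Pp; have [st|st] := boolP (0 < s <= t).
  have [p0 pN _] := Pp; rewrite -p0 -pN in st.
  by have [j jN H] := find_oc st; rewrite !(stepf_at _ Pp jN H).
by rewrite !(stepf_out _ Pp st) normr0.
Qed.

(** The length of the intersection of [0, t] with ]a, b], for [0 <= a <= b]
    and [0 <= t]. *)
Definition overlap (a b t : R) : R := Num.min b (Num.max a t) - a.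

Lemma overlap_le (a b t u : R) : t <= u -> overlap a b t <= overlap a b u.
Proof.
move=> tu; rewrite /overlap.
case: (leP a t) => h1; case: (leP a u) => h2;
  case: (leP b t) => h3; case: (leP b u) => h4; case: (leP b a) => h5; lra.
Qed.

Lemma overlap_left (a b t : R) : a <= b -> t <= a -> overlap a b t = 0.
Proof. by move=> ab ta; rewrite /overlap max_l// min_r// subrr. Qed.

Lemma overlap_right (a b t : R) : a <= b -> b <= t -> overlap a b t = b - a.
Proof.
by move=> ab bt; rewrite /overlap max_r ?min_l//; exact: le_trans bt.
Qed.

Lemma overlap_mid (a b t : R) : a <= t <= b -> overlap a b t = t - a.
Proof. by move=> /andP[at_ tb]; rewrite /overlap max_r// min_r. Qed.

Notation mu := (@lebesgue_measure R).

Lemma integrable_indic_oc (a b c t : R) :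
  mu.-integrable `[0, t] (EFin \o (fun s => c * \1_(`]a, b]) s)).
Proof.
have H : mu.-integrable `[0, t] (EFin \o (\1_(`]a, b]) : R -> R)).
  apply: (@integrableS _ _ _ mu setT) => //; exact: integrable_indic_itv.
exact: (@integrableZl _ _ _ mu `[0, t] _ c _ H).
Qed.

Lemma Rintegral_indic_oc (a b t : R) : 0 <= a -> a <= b -> 0 <= t ->
  \int[mu]_(s in `[0, t]) \1_(`]a, b]) s = overlap a b t.
Proof.
move=> a0 ab t0; rewrite /Rintegral integral_indic//.
have -> : (`]a, b] `&` `[0, t] = `]a, Num.min b t])%classic.
  apply/seteqP; split => s /=; rewrite !in_itv/= le_min.
    by move=> [/andP[-> ->] /andP[_ ->]].
  move=> /and3P[as_ sb st]; rewrite as_ sb st; split => //.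
  by rewrite (le_trans a0 (ltW as_)).
rewrite [X in fine X](lebesgue_measure_itv `]a, Num.min b t])/= lte_fin.
have [at_|ta] := ltP a (Num.min b t).
  rewrite lt_min in at_; case/andP: at_ => ab' at_.
  by rewrite /= /overlap (max_r (ltW at_)).
move: ta; rewrite /overlap /= ge_min => /orP[ba|ta].
  have -> : b = a by apply/eqP; rewrite eq_le ab ba.
  by rewrite min_l ?le_max ?lexx// subrr.
by rewrite max_l// min_r// subrr.
Qed.

Lemma Rintegral_step t u N p c : partition_of u N p -> 0 <= t ->
  \int[mu]_(s in `[0, t]) stepf N p c s =
  \sum_(j < N) c j * overlap (p j) (p j.+1) t.
Proof.
move=> Pp t0; pose F n s := \sum_(j < n) c j * \1_(`]p j, p j.+1]) (s : R) : R.
have F_int n : mu.-integrable `[0, t] (EFin \o F n).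
  have -> : EFin \o F n =
      (fun s => (\sum_(j < n) (c j * \1_(`]p j, p j.+1]) s)%R%:E)%E).
    by apply/funext => s; rewrite /= /F -sumEFin.
  apply: integrable_sum => // j _; exact: integrable_indic_oc.
suff H n : (n <= N)%N -> \int[mu]_(s in `[0, t]) F n s =
    \sum_(j < n) c j * overlap (p j) (p j.+1) t by exact: H.
elim: n => [_|n IH nN].
  rewrite /F; under eq_Rintegral do rewrite big_ord0.
  by rewrite Rintegral_cst// mul0r big_ord0.
have -> : F n.+1 = fun s => F n s + c n * \1_(`]p n, p n.+1]) s.
  by apply/funext => s; rewrite /F big_ord_recr.
rewrite RintegralD//; last exact: integrable_indic_oc.
rewrite IH ?(ltnW nN)// big_ord_recr/= RintegralZl//.
  rewrite Rintegral_indic_oc// ?(part_ge0 Pp) ?(ltnW nN)//.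
  by have [_ _ p_incr] := Pp; exact/ltW/p_incr.
by apply: (@integrableS _ _ _ mu setT) => //; exact: integrable_indic_itv.
Qed.

(** The point [p j.+1] exceeds [rho k] and belongs to [rho], so it is at least
    the next point of [rho]. *)
Lemma refine_find u N p K rho k : partition_of u N p -> partition_of u K rho ->
  (forall j, (j <= N)%N -> exists2 i, (i <= K)%N & rho i = p j) ->
  (k < K)%N ->
  exists2 j, (j < N)%N & p j <= rho k /\ rho k.+1 <= p j.+1.
Proof.
move=> Pp Pr sub kK; have [p0 pN _] := Pp; have [r0 rK r_incr] := Pr.
have [|j jN /andP[pj jp]] := @find_co p N (rho k).
  rewrite p0 pN; apply/andP; split; first exact: part_ge0 Pr (ltnW kK).
  exact: lt_le_trans (r_incr _ kK) (part_le_end Pr kK).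
exists j => //; split => //.
have [i iK ri] := sub _ jN; rewrite -ri in jp *.
apply: (part_le Pr); rewrite iK andbT ltnNge; apply/negP => ik.
have := part_le Pr (_ : i <= k <= K)%N; rewrite ik ltnW// => /(_ isT).
by rewrite leNgt jp.
Qed.

(** A step function is constant on each finer interval, hence equal there to its
    value at the right end point. *)
Lemma stepf_refine u N p K rho c : partition_of u N p -> partition_of u K rho ->
  (forall j, (j <= N)%N -> exists2 i, (i <= K)%N & rho i = p j) ->
  stepf N p c = stepf K rho (fun k => stepf N p c (rho k.+1)).
Proof.
move=> Pp Pr sub; apply/funext => s.
have [su|su] := boolP (0 < s <= u); last first.
  by rewrite (stepf_out _ Pp su) (stepf_out _ Pr su).
have [r0 rK r_incr] := Pr; rewrite -r0 -rK in su.
have [k kK /andP[ks sk]] := find_oc su.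
rewrite (stepf_at _ Pr kK) ?ks//.
have [j jN [pj jp]] := refine_find Pp Pr sub kK.
rewrite !(stepf_at _ Pp jN)//.
  by rewrite (le_lt_trans pj) ?r_incr.
by rewrite (le_lt_trans pj ks) (le_trans sk).
Qed.

(** The sorted union of both sets of points. *)
Lemma common_partition u N p N' p' :
  partition_of u N p -> partition_of u N' p' ->
  exists K rho, [/\ partition_of u K rho,
    forall j, (j <= N)%N -> exists2 i, (i <= K)%N & rho i = p j &
    forall j, (j <= N')%N -> exists2 i, (i <= K)%N & rho i = p' j].
Proof.
move=> Pp Pp'.
pose pts q n := [seq q i | i <- iota 0 n.+1] : seq R.
pose r := sort <=%R (undup (pts p N ++ pts p' N')).
have mem_r x : (x \in r) = (x \in pts p N) || (x \in pts p' N').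
  by rewrite mem_sort mem_undup mem_cat.
have ptsP q n j : (j <= n)%N -> q j \in pts q n.
  by move=> jn; apply/mapP; exists j => //; rewrite mem_iota.
have r_sorted : sorted <%R r.
  by rewrite sort_lt_sorted undup_uniq.
have r_bound x : x \in r -> 0 <= x <= u.
  rewrite mem_r => /orP[] /mapP[j]; rewrite mem_iota add0n ltnS => /= jn ->.
    by rewrite (part_ge0 Pp) ?(part_le_end Pp).
  by rewrite (part_ge0 Pp') ?(part_le_end Pp').
have r_find x : x \in r -> exists2 i, (i <= (size r).-1)%N & nth 0 r i = x.
  move=> xr; exists (index x r); last by rewrite nth_index.
  by move: xr; rewrite -index_mem; case: (size r).
have [p0 pN _] := Pp.
have r0 : 0 \in r by rewrite mem_r -p0 ptsP.
have ru : u \in r by rewrite mem_r -pN ptsP.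
have r_gt0 : (0 < size r)%N by case: (r) r0.
have r_lt i j : (i < j)%N -> (j <= (size r).-1)%N -> nth 0 r i < nth 0 r j.
  move=> ij jr; have jr' : (j < size r)%N by rewrite -(prednK r_gt0).
  by rewrite (lt_sorted_ltn_nth _ r_sorted)// inE// (ltn_trans ij).
exists (size r).-1, (nth 0 r); split.
- split.
  + have [[|i] iK ri //] := r_find _ r0.
    have := r_lt _ _ (ltn0Sn i) iK; rewrite ri.
    by have /andP[h _] := r_bound _ (mem_nth 0 r_gt0); rewrite ltNge h.
  + have [i iK ri] := r_find _ ru; move: (iK); rewrite leq_eqVlt.
    move=> /predU1P[<- //|iK'].
    have := r_lt _ _ iK' (leqnn _); rewrite ri.
    have /r_bound/andP[_ h] : nth 0 r (size r).-1 \in r.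
      by rewrite mem_nth// prednK.
    by rewrite ltNge h.
  + by move=> i iK; exact: r_lt.
- by move=> j jN; apply: r_find; rewrite mem_r ptsP.
- by move=> j jN; apply: r_find; rewrite mem_r (ptsP p')// orbT.
Qed.

End Partitions.

(** * The linear space of cylinder variables *)

Section CylinderSpace.
Variables (R : realType) (T : R).

Lemma lip2D : lip2 (fun a b : R => a + b).
Proof.
by exists 1 => // a b c d; rewrite mul1r opprD addrACA ler_normD.
Qed.

Lemma lip2Z (k : R) : lip2 (fun a _ : R => k * a).
Proof.
by exists `|k| => // a b c d; rewrite -mulrBr normrM ler_wpM2l// lerDl.
Qed.

Lemma lip2_norm : lip2 (fun a _ : R => `|a|).
Proof.
exists 1 => // a b c d; rewrite mul1r.
by apply: le_trans (ler_dist_dist _ _) _; rewrite lerDl.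
Qed.

Hypothesis T0 : 0 <= T.

Lemma H0_cst c : H0 T (fun _ : cpath T => c).
Proof.
exists 1%N, (fun=> 0), (fun=> c); split => //; first by rewrite lexx.
exact/ClLipP/poly_lip_cst.
Qed.

Lemma H0D (X Y : cpath T -> R) : H0 T X -> H0 T Y -> H0 T (fun w => X w + Y w).
Proof. exact: (H0_lip2 lip2D). Qed.

Lemma H0Z (c : R) (X : cpath T -> R) : H0 T X -> H0 T (fun w => c * X w).
Proof. by move=> HX; exact: (H0_lip2 (lip2Z c) HX HX). Qed.

Lemma H0_norm (X : cpath T -> R) : H0 T X -> H0 T (fun w => `|X w|).
Proof. by move=> HX; exact: (H0_lip2 lip2_norm HX HX). Qed.

Lemma H0_sum (I : Type) (r : seq I) (P : pred I) (X : I -> cpath T -> R) :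
  (forall i, P i -> H0 T (X i)) -> H0 T (fun w => \sum_(i <- r | P i) X i w).
Proof.
move=> HX; elim: r => [|i r IH].
  by under eq_fun do rewrite big_nil; exact: H0_cst.
under eq_fun do rewrite big_cons.
by case: (boolP (P i)) => // Pi; apply: H0D => //; exact: HX.
Qed.

Lemma H0_sqr_incr a b : 0 <= a <= T -> 0 <= b <= T ->
  H0 T (fun w : cpath T => (B b w - B a w) ^+ 2).
Proof.
move=> aT bT; pose phi (z : 'rV[R]_2) := (z 0 1 - z 0 0) ^+ 2.
exists 2%N, (fun i : 'I_2 => if i == 0 then a else b), phi; split => //.
- by move=> i; case: ifP.
- apply/ClLipP; rewrite /phi; under eq_fun do rewrite expr2.
  have h : poly_lip (fun z : 'rV[R]_2 => z 0 1 - z 0 0).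
    apply: (poly_lip2 (f := fun a b => a - b)); try exact: poly_lip_coord.
    exists 1 => // u v x y; rewrite mul1r.
    have -> : u - v - (x - y) = (u - x) - (v - y) by ring.
    exact: ler_normB.
  exact: poly_lipM.
- by apply/funext => w; rewrite /phi !mxE.
Qed.

End CylinderSpace.

(** * Completions *)

Section Completions.
Variables (R : realType) (V : lmodType R) (D : set V) (p : V -> R).
Hypothesis D0 : D 0.
Hypothesis Dlin : forall (a : R) x y, D x -> D y -> D (a *: x + y).
Variable M : completion D p.

Lemma embed0 : embed M 0 = 0.
Proof.
have := embed_linear M 1 D0 D0; rewrite scaler0 addr0 scale1r => /eqP.
by rewrite -subr_eq subrr => /eqP.
Qed.

Lemma embedB x y : D x -> D y -> embed M (x - y) = embed M x - embed M y.
Proof.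
by move=> Dx Dy; rewrite -scaleN1r addrC embed_linear// scaleN1r addrC.
Qed.

Lemma D_sub x y : D x -> D y -> D (x - y).
Proof. by move=> Dx Dy; rewrite -scaleN1r addrC; exact: Dlin. Qed.

Lemma D_sum m (a : nat -> R) (x : nat -> V) : (forall i, (i < m)%N -> D (x i)) ->
  D (\sum_(i < m) a i *: x i).
Proof.
elim: m => [_|m IH Dx]; first by rewrite big_ord0.
rewrite big_ord_recr/= addrC; apply: Dlin; first exact: Dx.
by apply: IH => i im; apply: Dx; exact: ltnW.
Qed.

Lemma embed_sum m (a : nat -> R) (x : nat -> V) :
  (forall i, (i < m)%N -> D (x i)) ->
  embed M (\sum_(i < m) a i *: x i) = \sum_(i < m) a i *: embed M (x i).
Proof.
elim: m => [_|m IH Dx]; first by rewrite !big_ord0 embed0.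
rewrite !big_ord_recr/= addrC embed_linear//; last 2 first.
- exact: Dx.
- by apply: D_sum => i im; apply: Dx; exact: ltnW.
by rewrite IH 1?addrC// => i im; apply: Dx; exact: ltnW.
Qed.

Lemma embed_dist x y : D x -> D y -> `|embed M x - embed M y| = p (x - y).
Proof. by move=> Dx Dy; rewrite -embedB// embed_isometry//; exact: D_sub. Qed.

Lemma embed_approx (h : M) (e : R) : 0 < e ->
  exists2 x, D x & `|h - embed M x| < e.
Proof.
move=> e0; have [||y [/= yh [x Dx xy]]] := @embed_dense _ _ _ _ M (ball h e).
- by exists h; exact: ballxx.
- exact: ball_open.
exists x => //; rewrite xy; move: yh; by rewrite -ball_normE.
Qed.

(** A negative value would be taken on a nonempty open set, which meets the
    image of [D]. *)
Lemma dense_ge0 (g : M -> R) : continuous g ->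
  (forall x, D x -> 0 <= g (embed M x)) -> forall h, 0 <= g h.
Proof.
move=> g_cont g_ge0 h; rewrite leNgt; apply/negP => gh.
have [||y [/= yg [x Dx xy]]] :=
    @embed_dense _ _ _ _ M (g @^-1` [set r | r < 0]).
- by exists h.
- by move/continuousP : g_cont; apply; exact: open_lt.
by move: yg; rewrite -xy ltNge g_ge0.
Qed.

End Completions.

Definition incr_sum (R : realType) (V : lmodType R) (m : nat) (e : nat -> R)
    (u : nat -> V) : V :=
  \sum_(i < m) e i *: (u i.+1 - u i).

Lemma cvg_incr_sum (R : realType) (V : normedModType R) (I : Type)
    (F : set_system I) (FF : Filter F) m (e : nat -> R) (u : I -> nat -> V)
    (l : nat -> V) :
  (forall i, (i <= m)%N -> u x i @[x --> F] --> l i) ->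
  incr_sum m e (u x) @[x --> F] --> incr_sum m e l.
Proof.
rewrite /incr_sum; elim: m => [_|m IH ul].
  by under eq_fun do rewrite big_ord0; rewrite big_ord0; exact: cvg_cst.
under eq_fun do rewrite big_ord_recr /=; rewrite big_ord_recr /=.
apply: cvgD; first by apply: IH => i im; apply: ul; exact: leqW.
by apply: cvgZl_tmp; apply: cvgB; apply: ul.
Qed.

(** * Uniform refinements *)

Section UniformRefinement.
Variables (R : realType) (q : nat -> R) (K : nat).
Hypothesis K0 : (0 < K)%N.

(** Each interval of [q] is cut into [K] equal pieces. *)
Definition fine_part (k : nat) : R :=
  q (k %/ K) + (k %% K)%:R / K%:R * (q (k %/ K).+1 - q (k %/ K)).

Lemma fine_part_mul i : fine_part (i * K) = q i.
Proof. by rewrite /fine_part mulnK// modnMl !mul0r addr0. Qed.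

Lemma fine_part_incr k :
  fine_part k.+1 - fine_part k = (q (k %/ K).+1 - q (k %/ K)) / K%:R.
Proof.
have K1 : (K%:R : R) != 0 by rewrite pnatr_eq0 -lt0n.
rewrite /fine_part; have kE := divn_eq k K; have kK := ltn_pmod k K0.
set a := (k %/ K)%N in kE *; set b := (k %% K)%N in kE kK *.
have [bK|bK] := ltnP b.+1 K.
  have -> : k.+1 = (a * K + b.+1)%N by rewrite kE addnS.
  by rewrite divnMDl// divn_small// addn0 modnMDl modn_small// -natr1; field.
have bE : b.+1 = K by apply/eqP; rewrite eqn_leq bK kK.
have -> : k.+1 = (a.+1 * K)%N by rewrite kE -addnS bE mulSn addnC.
rewrite mulnK// modnMl !mul0r addr0.
have -> : (b%:R : R) = K%:R - 1 by rewrite -bE -natr1 addrK.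
by field.
Qed.

Variables (T : R) (m : nat).
Hypothesis Pq : partition_of T m q.

Lemma fine_partition i : (i <= m)%N -> partition_of (q i) (i * K) fine_part.
Proof.
move=> im; have [q0 _ q_incr] := Pq; split.
- by rewrite -(mul0n K) fine_part_mul.
- exact: fine_part_mul.
- move=> k kK; rewrite -subr_gt0 fine_part_incr divr_gt0 ?ltr0n// subr_gt0.
  by apply: q_incr; apply: leq_trans im; rewrite ltn_divLR.
Qed.

Lemma mesh_fine_part i : (i <= m)%N -> mesh (i * K) fine_part <= T / K%:R.
Proof.
move=> im; have T0 : 0 <= T by have := part_ge0 Pq (leqnn m); have [_ ->] := Pq.
apply: bigmax_le; first by rewrite divr_ge0.
move=> [k /= kK] _; rewrite fine_part_incr ler_wpM2r// ?invr_ge0//.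
have km : (k %/ K < m)%N by apply: leq_trans im; rewrite ltn_divLR.
have h1 := part_le_end Pq km; have h2 := part_ge0 Pq (ltnW km).
lra.
Qed.

Lemma mesh_ge0 N p : 0 <= mesh N p :> R.
Proof. exact: bigmax_ge_id. Qed.

End UniformRefinement.

Lemma sum_block (V : nmodType) (m K : nat) (F : nat -> V) :
  \sum_(k < m * K) F k = \sum_(i < m) \sum_(i * K <= k < i.+1 * K) F k.
Proof.
rewrite -(big_mkord xpredT F) big_nat_mul.
exact: (big_mkord xpredT (fun i => \sum_(i * K <= k < i.+1 * K) F k)).
Qed.

Lemma sum_block_cst (V : nmodType) (m K : nat) (F : nat -> V) : (0 < K)%N ->
  \sum_(k < m * K) F (k %/ K)%N = \sum_(i < m) F i *+ K.
Proof.
move=> K0; rewrite (sum_block m K (fun k => F (k %/ K)%N)).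
apply: eq_bigr => i _; rewrite (eq_big_nat _ _ (F2 := fun=> F i)).
  by rewrite sumr_const_nat mulSn addnK.
move=> k /andP[ik ki]; congr F; apply/eqP; rewrite eqn_leq.
by rewrite -ltnS ltn_divLR// ki leq_divRL.
Qed.

(** * Lower bound for signed increments of the quadratic variation *)

Section LowerBound.
Variables (R : realType) (T slo shi : R) (E : (cpath T -> R) -> R).
Hypothesis T0 : 0 < T.
Hypothesis HE : is_G_expectation slo shi E.

Lemma GfunM a b : 0 <= b -> Gfun slo shi (a * b) = Gfun slo shi a * b.
Proof.
move=> b0; rewrite /Gfun -(mulNr a b).
have h c : Num.max (c * b) 0 = Num.max c 0 * b by rewrite maxr_pMl// mul0r.
by rewrite !h; ring.
Qed.

(** The increments are distributed as [Num.sqrt (p k.+1 - p k) * xi k], so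
    interval lengths become weights of the squares of the [xi k]. *)
Lemma expect_sqr_incr m p (e : nat -> R) : (0 < m)%N -> partition_of T m p ->
  E (fun w => \sum_(k < m) e k * (B (p k.+1) w - B (p k) w) ^+ 2) =
  \sum_(k < m) 2 * (Gfun slo shi (e k) * (p k.+1 - p k)).
Proof.
move=> m0 Pp; have [_ [S [xi [xiG xiI incr]]]] := HE.
pose phi (z : 'rV[R]_m) := \sum_(k < m) e k * z 0 k ^+ 2.
have phi_lip : ClLip phi.
  apply/ClLipP; apply: poly_lip_sum => k _.
  apply: poly_lipM; first exact: poly_lip_cst.
  under eq_fun do rewrite expr2.
  by apply: poly_lipM; exact: poly_lip_coord.
have [_ _ p_incr] := Pp.
transitivity (E (fun w => phi (\row_(i < m) (B (p i.+1) w - B (p i) w)))).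
  by congr E; apply/funext => w; apply: eq_bigr => k _; rewrite mxE.
rewrite (incr T)//.
transitivity (expect (fun w => \sum_(k < m)
    (e k * (p k.+1 - p k)) * xi k w ^+ 2)).
  congr expect; apply/funext => w; apply: eq_bigr => k _; rewrite mxE exprMn.
  by rewrite sqr_sqrtr ?mulrA// subr_ge0 ltW// p_incr.
rewrite (expect_quadratic (fun k => e k * (p k.+1 - p k)) m xiG xiI).
by apply: eq_bigr => k _; rewrite GfunM// subr_ge0 ltW// p_incr.
Qed.

Variables (L : L1G_space E) (QV : R -> L).
Hypothesis HQV : is_quadratic_variation QV.

Lemma H0_zero : H0 T (0 : cpath T -> R^o).
Proof. exact: (H0_cst (ltW T0)). Qed.

Lemma H0_lin (a : R) (X Y : cpath T -> R^o) :
  H0 T X -> H0 T Y -> H0 T (a *: X + Y).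
Proof. by move=> HX HY; apply: H0D => //; exact: H0Z. Qed.

(** The approximating sums for all [QV (q i)] are taken along one family of
    refinements, so that their signed increments form a single quadratic form in
    the increments of [B]. Its expectation does not depend on the refinement. *)
Lemma qv_incr_lower m q (e : nat -> R) : (0 < m)%N -> partition_of T m q ->
  \sum_(i < m) 2 * (Gfun slo shi (e i) * (q i.+1 - q i)) <=
  `|incr_sum m e (fun i => QV (q i))|.
Proof.
move=> m0 Pq.
pose r n := fine_part q n.+1.
pose S n i : cpath T -> R^o :=
  fun w => \sum_(k < i * n.+1) (B (r n k.+1) w - B (r n k) w) ^+ 2.
have Pr n i (im : (i <= m)%N) : partition_of (q i) (i * n.+1) (r n).
  exact: (fine_partition _ Pq im).
have PrT n : partition_of T (m * n.+1) (r n).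
  by have [_ <- _] := Pq; exact: Pr.
have rT n k : (k <= m * n.+1)%N -> 0 <= r n k <= T.
  by move=> km; rewrite (part_ge0 (PrT n))// (part_le_end (PrT n)).
have HS n i : (i <= m)%N -> H0 T (S n i).
  move=> im; apply: (H0_sum (ltW T0)) => -[k /= ki] _.
  have km : (k < m * n.+1)%N by apply: leq_trans ki _; rewrite leq_mul2r im orbT.
  by apply: H0_sqr_incr; apply: rT => //; exact: ltnW.
have S_cvg i : (i <= m)%N -> embed L (S n i) @[n --> \oo] --> QV (q i).
  move=> im; apply: (HQV _ (N := fun n => (i * n.+1)%N) (p := r)).
  - by rewrite (part_ge0 Pq)// (part_le_end Pq).
  - by move=> n; exact: Pr.
  - apply: (@squeeze_cvgr _ _ _ _ (fun=> 0) (fun n => T * harmonic n)).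
    + near=> n; rewrite mesh_ge0 /=; exact: (mesh_fine_part _ Pq).
    + exact: cvg_cst.
    + rewrite -[X in _ --> X](mulr0 T); apply: cvgMl_tmp => //.
      exact: cvg_harmonic.
have lim : `|incr_sum m e (fun i => embed L (S n i))| @[n --> \oo] -->
    `|incr_sum m e (fun i => QV (q i))|.
  by apply: cvg_norm; exact: cvg_incr_sum.
apply: (cvgr_to_ge lim); near=> n.
have e1 : incr_sum m e (fun i => embed L (S n i)) =
    embed L (\sum_(i < m) e i *: (S n i.+1 - S n i)).
  rewrite (embed_sum H0_zero H0_lin L e (x := fun i => S n i.+1 - S n i)).
    by apply: eq_bigr => -[i im] _ /=; rewrite (embedB L)//; apply: HS => //; exact: ltnW.
  by move=> i im; apply: (D_sub H0_lin); apply: HS => //; exact: ltnW.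
have HX : H0 T (\sum_(i < m) e i *: (S n i.+1 - S n i)).
  apply: (D_sum H0_zero H0_lin e (x := fun i => S n i.+1 - S n i)) => i im.
  by apply: (D_sub H0_lin); apply: HS => //; exact: ltnW.
rewrite e1 embed_isometry//.
have e2 : \sum_(i < m) e i *: (S n i.+1 - S n i) =
    fun w => \sum_(k < m * n.+1) e (k %/ n.+1)%N *
      (B (r n k.+1) w - B (r n k) w) ^+ 2.
  apply/funext => w; rewrite fct_sumE.
  rewrite (sum_block m n.+1 (fun k => e (k %/ n.+1)%N *
      (B (r n k.+1) w - B (r n k) w) ^+ 2)).
  apply: eq_bigr => i _.
  transitivity (e i * (S n i.+1 w - S n i w)); first by [].
  rewrite /S -(big_mkord xpredT (fun k => (B (r n k.+1) w - B (r n k) w) ^+ 2)).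
  rewrite -(big_mkord xpredT (fun k => (B (r n k.+1) w - B (r n k) w) ^+ 2)).
  rewrite (big_cat_nat (n := (i * n.+1)%N))//= ?leq_mul2r ?leqnSn ?orbT//.
  rewrite addrAC subrr add0r mulr_sumr; apply: eq_big_nat => k /andP[ik ki].
  congr (e _ * _); apply/eqP; rewrite eqn_leq.
  by rewrite leq_divRL// ik /= -ltnS ltn_divLR.
move: HX; rewrite e2 /L1norm; set X := (X in H0 T X) => HX.
apply: (@le_trans _ _ (E X)); last first.
  have [[Emono _ _ _] _] := HE.
  by apply: Emono => //; [exact: H0_norm|move=> w; exact: ler_norm].
rewrite /X (@expect_sqr_incr (m * n.+1) (r n) (fun k => e (k %/ n.+1)%N))//;
  last by rewrite muln_gt0 m0.
under [leRHS]eq_bigr do rewrite fine_part_incr//.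
rewrite (@sum_block_cst _ m n.+1 (fun i =>
  2 * (Gfun slo shi (e i) * ((q i.+1 - q i) / n.+1%:R))))//.
apply: ler_sum => i _; rewrite -mulr_natr.
have n1 : (n.+1%:R : R) != 0 by rewrite pnatr_eq0.
by rewrite le_eqVlt; apply/orP; left; apply/eqP; field.
Unshelve. all: by end_near. Qed.

End LowerBound.

(** * Upper bound for signed increments of an integral process *)

Section StepProcesses.
Variables (R : realType) (T : R).
Hypothesis T0 : 0 < T.

Definition step N (p : nat -> R) (xi : nat -> cpath T -> R)
    : R -> cpath T -> R^o :=
  fun s w => stepf N p (xi^~ w) s.

Lemma H0G_step N p xi : partition_of T N p ->
  (forall j, (j < N)%N -> Lip (p j) (xi j)) -> H0G (step N p xi).
Proof. by move=> Pp Hxi; exists N, p, xi. Qed.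

(** The coefficients on a finer partition are values of the process at right
    end points; they keep the required measurability because a fine interval
    starts no earlier than the coarse one that contains it. *)
Lemma step_refine N p xi K rho : partition_of T N p -> partition_of T K rho ->
  (forall j, (j <= N)%N -> exists2 i, (i <= K)%N & rho i = p j) ->
  (forall j, (j < N)%N -> Lip (p j) (xi j)) ->
  exists2 xi', (forall k, (k < K)%N -> Lip (rho k) (xi' k)) &
    step N p xi = step K rho xi'.
Proof.
move=> Pp Pr sub Hxi; exists (fun k => step N p xi (rho k.+1)).
- move=> k kK; have [j jN [pj jp]] := refine_find Pp Pr sub kK.
  apply: (Lip_le pj).
  have -> : step N p xi (rho k.+1) = xi j; last exact: Hxi.
  apply/funext => w; apply: (stepf_at _ Pp jN).
  by rewrite jp andbT (le_lt_trans pj)//; have [_ _] := Pr; apply.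
- apply/funext => s; apply/funext => w.
  exact: (congr1 (@^~ s) (stepf_refine (xi^~ w) Pp Pr sub)).
Qed.

(** Linear operations on [H0G] reduce to operations on coefficients once both
    processes are written on the same partition. *)
Lemma H0G_common (eta eta' : R -> cpath T -> R) : H0G eta -> H0G eta' ->
  exists K rho xi xi', [/\ partition_of T K rho,
    forall k, (k < K)%N -> Lip (rho k) (xi k),
    forall k, (k < K)%N -> Lip (rho k) (xi' k),
    eta = step K rho xi & eta' = step K rho xi'].
Proof.
move=> [N [p [xi [Pp Hxi ->]]]] [N' [p' [xi' [Pp' Hxi' ->]]]].
have [K [rho [Pr sub sub']]] := common_partition Pp Pp'.
have [zeta Hz ez] := step_refine Pp Pr sub Hxi.
have [zeta' Hz' ez'] := step_refine Pp' Pr sub' Hxi'.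
by exists K, rho, zeta, zeta'.
Qed.

Lemma stepB K rho xi xi' :
  step K rho xi - step K rho xi' = step K rho (fun j w => xi j w - xi' j w).
Proof.
apply/funext => s; apply/funext => w.
transitivity (step K rho xi s w - step K rho xi' s w); first by [].
rewrite /step /stepf -sumrB; apply: eq_bigr => j _.
by rewrite mulrBl.
Qed.

Lemma integral_step t K rho xi w : partition_of T K rho -> 0 <= t ->
  integral_process t (step K rho xi) w =
  \sum_(j < K) xi j w * overlap (rho j) (rho j.+1) t.
Proof. by move=> Pr t0; rewrite /integral_process (Rintegral_step _ Pr). Qed.

Lemma H0_integral_step t K rho xi : partition_of T K rho -> 0 <= t ->
  (forall k, (k < K)%N -> Lip (rho k) (xi k)) ->
  H0 T (integral_process t (step K rho xi)).
Proof.
move=> Pr t0 Hxi; have -> : integral_process t (step K rho xi) =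
    fun w => \sum_(j < K) xi j w * overlap (rho j) (rho j.+1) t.
  by apply/funext => w; exact: integral_step.
apply: (H0_sum (ltW T0)) => -[j jK] _ /=; under eq_fun do rewrite mulrC.
by apply: H0Z; apply: Lip_H0 (Hxi j jK); exact: part_le_end Pr (ltnW jK).
Qed.

Lemma integral_norm_step K rho xi w : partition_of T K rho ->
  integral_process T (fun s w => `|step K rho xi s w|) w =
  \sum_(j < K) `|xi j w| * (rho j.+1 - rho j).
Proof.
move=> Pr; rewrite /integral_process.
under eq_Rintegral do rewrite (stepf_norm _ _ Pr).
rewrite (Rintegral_step _ Pr) ?ltW//; apply: eq_bigr => -[j jK] _ /=.
rewrite overlap_right ?(part_le_end Pr)// ltW//.
by have [_ _] := Pr; apply.
Qed.

(** The overlap with [a, b] is nondecreasing in time, so its total variation is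
    its final value. *)
Lemma overlap_incr_bound m q (e : nat -> R) (a b : R) : partition_of T m q ->
  (forall i, `|e i| <= 1) -> 0 <= a -> a <= b -> b <= T ->
  `|\sum_(i < m) e i * (overlap a b (q i.+1) - overlap a b (q i))| <= b - a.
Proof.
move=> Pq e1 a0 ab bT; have [q0 qm q_incr] := Pq.
apply: le_trans (ler_norm_sum _ _ _) _.
apply: (@le_trans _ _
    (\sum_(i < m) (overlap a b (q i.+1) - overlap a b (q i)))).
  apply: ler_sum => -[i im] _ /=.
  have h : 0 <= overlap a b (q i.+1) - overlap a b (q i).
    by rewrite subr_ge0 overlap_le// ltW// q_incr.
  by rewrite normrM (ger0_norm h) ler_piMl.
rewrite -(big_mkord xpredT (fun i => overlap a b (q i.+1) - overlap a b (q i))).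
rewrite (telescope_sumr (fun i => overlap a b (q i)))// q0 qm.
by rewrite overlap_right// overlap_left// subr0.
Qed.

End StepProcesses.

Section UpperBound.
Variables (R : realType) (T : R) (E : (cpath T -> R) -> R).
Variables (L : L1G_space E) (M : M1G_space E) (I : R -> M -> L).
Hypothesis T0 : 0 < T.
Hypothesis HE : sublinear_expectation (H0 T) E.
Hypothesis HI : is_integral I.
Variables (m : nat) (q e : nat -> R).
Hypothesis Pq : partition_of T m q.

Let L0 := H0_zero T0.
Let Llin := @H0_lin R T.

(** For a step process the signed integral is computed from the coefficients
    pathwise. *)
Lemma incr_integral_embed K rho xi : partition_of T K rho ->
  (forall k, (k < K)%N -> Lip (rho k) (xi k)) ->
  let eta := step K rho xi in
  let Z : cpath T -> R^o := fun w => \sum_(j < K) xi j w * \sum_(i < m)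
      e i * (overlap (rho j) (rho j.+1) (q i.+1) - overlap (rho j) (rho j.+1) (q i)) in
  H0 T Z /\ incr_sum m e (fun i => I (q i) (embed M eta)) = embed L Z.
Proof.
move=> Pr Hxi eta Z.
have qT i : (i <= m)%N -> 0 <= q i <= T.
  by move=> im; rewrite (part_ge0 Pq)// (part_le_end Pq).
have Heta : H0G eta by exact: H0G_step.
pose Y i : cpath T -> R^o := integral_process (q i) eta.
have HY i : (i <= m)%N -> H0 T (Y i).
  by move=> /qT/andP[q0 _]; exact: H0_integral_step.
have IY i : (i <= m)%N -> I (q i) (embed M eta) = embed L (Y i).
  by move=> /qT/HI[_]; exact.
have ZE : Z = \sum_(i < m) e i *: (Y i.+1 - Y i).
  apply/funext => w; rewrite fct_sumE /Z.
  under eq_bigr do rewrite mulr_sumr; rewrite exchange_big/=.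
  apply: eq_bigr => -[i im] _ /=.
  transitivity (e i * (Y i.+1 w - Y i w)); last by [].
  have /andP[q0 _] := qT _ im; have /andP[q1 _] := qT _ (ltnW im).
  rewrite /Y !integral_step// -sumrB mulr_sumr; apply: eq_bigr => j _.
  by ring.
have HYB i : (i < m)%N -> H0 T (Y i.+1 - Y i).
  by move=> im; apply: (D_sub Llin); apply: HY => //; exact: ltnW.
split.
  by rewrite ZE; apply: (D_sum L0 Llin e (x := fun i => Y i.+1 - Y i)).
rewrite ZE (embed_sum L0 Llin L e (x := fun i => Y i.+1 - Y i))//.
apply: eq_bigr => -[i im] _ /=; rewrite !IY ?(ltnW im)//.
by rewrite (embedB L)//; apply: HY => //; exact: ltnW.
Qed.

Hypothesis e1 : forall i, `|e i| <= 1.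

(** On step processes this is the bound of the integral of sgn eta by the
    integral of the absolute value of eta; density extends it to [M]. *)
Lemma incr_integral_lip (eta : R -> cpath T -> R^o) (h : M) : H0G eta ->
  `|incr_sum m e (fun i => I (q i) h) -
    incr_sum m e (fun i => I (q i) (embed M eta))| <= `|h - embed M eta|.
Proof.
move=> Heta; rewrite -subr_ge0.
pose J x := incr_sum m e (fun i => I (q i) x).
have J_cont : continuous J.
  move=> x; apply: cvg_incr_sum => i im.
  have [|c _] := HI (t := q i); last exact: c.
  by rewrite (part_ge0 Pq)// (part_le_end Pq).
move: h; apply: (@dense_ge0 _ _ _ _ M (fun h =>
    `|h - embed M eta| - `|J h - J (embed M eta)|)).
  move=> x; apply: cvgB; apply: cvg_norm; apply: cvgB.
  - exact: cvg_id.
  - exact: cvg_cst.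
  - exact: J_cont.
  - exact: cvg_cst.
move=> eta' Heta'; rewrite subr_ge0.
have [K [rho [xi [xi' [Pr Hxi Hxi' -> ->]]]]] := H0G_common Heta' Heta.
have [HZ ZE] := incr_integral_embed Pr Hxi.
have [HZ' ZE'] := incr_integral_embed Pr Hxi'.
rewrite /J ZE ZE' (embed_dist Llin L HZ HZ').
pose zeta j (w : cpath T) := xi j w - xi' j w.
have Hzeta k : (k < K)%N -> Lip (rho k) (zeta k).
  by move=> kK; apply: LipB; [exact: Hxi|exact: Hxi'].
have -> : embed M (step K rho xi) - embed M (step K rho xi') =
    embed M (step K rho zeta).
  rewrite -stepB -scaleN1r addrC -embed_linear; try exact: H0G_step.
  by rewrite addrC scaleN1r.
rewrite embed_isometry; last exact: H0G_step.
rewrite /M1norm /L1norm; have [Emono _ _ _] := HE; apply: Emono.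
- have -> : integral_process T (fun s w => `|step K rho zeta s w|) =
      fun w => \sum_(j < K) `|zeta j w| * (rho j.+1 - rho j).
    by apply/funext => w; exact: integral_norm_step.
  apply: (H0_sum (ltW T0)) => -[j jK] _ /=; under eq_fun do rewrite mulrC.
  apply: H0Z; apply: H0_norm; apply: Lip_H0 (Hzeta j jK).
  exact: part_le_end Pr (ltnW jK).
- by apply: H0_norm; exact: (D_sub Llin).
- move=> w; rewrite integral_norm_step//.
  set Z := (X in `|(X - _) w|); set Z' := (X in `|(_ - X) w|).
  have -> : (Z - Z') w = Z w - Z' w by [].
  rewrite /Z /Z' -sumrB; apply: le_trans (ler_norm_sum _ _ _) _.
  apply: ler_sum => -[j jK] _ /=; rewrite -mulrBl normrM ler_wpM2l//.
  apply: (overlap_incr_bound Pq) => //.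
exact: part_ge0 Pr (ltnW jK).
  + by have [_ _ r_incr] := Pr; exact/ltW/r_incr.
  + exact: part_le_end Pr jK.
Qed.

End UpperBound.

(** * Midpoints *)

Section Midpoints.
Variables (R : realType) (T : R) (N : nat) (p : nat -> R).
Hypothesis Pp : partition_of T N p.

Definition midpoints (i : nat) : R :=
  if odd i then (p i./2 + p i./2.+1) / 2 else p i./2.

Definition alternating (i : nat) : R := if odd i then -1 else 1.

Lemma midpoints_even j : midpoints j.*2 = p j.
Proof. by rewrite /midpoints odd_double doubleK. Qed.

Lemma midpoints_odd j : midpoints j.*2.+1 = (p j + p j.+1) / 2.
Proof. by rewrite /midpoints /= odd_double uphalf_double. Qed.

Lemma midpoints_incr i :
  midpoints i.+1 - midpoints i = (p i./2.+1 - p i./2) / 2.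
Proof.
rewrite -[i]odd_double_half; set j := i./2; case: (odd i); rewrite ?add1n ?add0n /=.
  rewrite -doubleS midpoints_even midpoints_odd uphalf_double; lra.
by rewrite midpoints_even midpoints_odd doubleK; lra.
Qed.

Lemma midpoints_partition : partition_of T N.*2 midpoints.
Proof.
have [p0 pN p_incr] := Pp; split.
- by rewrite -(midpoints_even 0) in p0.
- by rewrite midpoints_even.
- move=> i iN; rewrite -subr_gt0 midpoints_incr divr_gt0// subr_gt0.
  by apply: p_incr; lia.
Qed.

Lemma sum_double (V : nmodType) (F : nat -> V) n :
  \sum_(i < n.*2) F i = \sum_(j < n) (F j.*2 + F j.*2.+1).
Proof.
elim: n => [|n IH]; first by rewrite !big_ord0.
by rewrite doubleS !big_ord_recr/= IH addrA.
Qed.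

Lemma alternating_even j : alternating j.*2 = 1.
Proof. by rewrite /alternating odd_double. Qed.

Lemma alternating_odd j : alternating j.*2.+1 = -1.
Proof. by rewrite /alternating /= odd_double. Qed.

(** The two halves of each interval of [p] cancel. *)
Lemma overlap_midpoints j : (j < N)%N ->
  \sum_(i < N.*2) alternating i *
    (overlap (p j) (p j.+1) (midpoints i.+1) -
     overlap (p j) (p j.+1) (midpoints i)) = 0.
Proof.
move=> jN; rewrite (sum_double (fun i => alternating i *
  (overlap (p j) (p j.+1) (midpoints i.+1) -
   overlap (p j) (p j.+1) (midpoints i)))).
apply: big1 => -[l lN] _ /=.
rewrite alternating_even alternating_odd -doubleS !midpoints_even midpoints_odd.
have [_ _ p_incr] := Pp.
have pj := p_incr _ jN; have pl := p_incr _ lN.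
have [lj|jl|jl] := ltngtP l j.
- have h := part_le Pp (_ : (l.+1 <= j <= N)%N); rewrite lj ltnW// in h.
  by have := h isT => h'; rewrite !overlap_left; lra.
- have h := part_le Pp (_ : (j.+1 <= l <= N)%N); rewrite jl ltnW// in h.
  by have := h isT => h'; rewrite !overlap_right; lra.
- by rewrite jl !overlap_mid; try (apply/andP; split); lra.
Qed.

End Midpoints.

Theorem corollary3p3 (R : realType) (T slo shi : R)
    (E : (cpath T -> R) -> R) (L : L1G_space E) (M : M1G_space E)
    (I : R -> M -> L) (QV : R -> L) :
  0 < T -> 0 < slo -> slo < shi ->
  is_G_expectation slo shi E ->
  is_integral I ->
  is_quadratic_variation QV ->
  ~ exists h : M, forall t, 0 <= t <= T -> QV t = I t h.
Proof.
move=> T0 slo0 slo_shi HE HI HQV [h QVh].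
pose c := T / 2 * (shi ^+ 2 - slo ^+ 2).
have c0 : 0 < c.
  rewrite /c subr_sqr; apply: mulr_gt0; first by rewrite divr_gt0.
  by apply: mulr_gt0; lra.
have [eta Heta h_eta] := embed_approx h c0.
have [N [p [xi [Pp Hxi etaE]]]] := Heta.
have Pq := midpoints_partition Pp.
set q := midpoints p in Pq; pose e := @alternating R.
have e1 i : `|e i| <= 1 by rewrite /e /alternating; case: ifP; rewrite ?normrN normr1.
have N0 : (0 < N)%N.
  rewrite lt0n; apply/eqP => N0; have [p0 pN _] := Pp.
  by move: pN T0; rewrite N0 p0 => <-; rewrite ltxx.
have [HE0 _] := HE.
have lower := qv_incr_lower T0 HE HQV e (_ : 0 < N.*2)%N Pq.
rewrite double_gt0 in lower; have {lower} := lower N0.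
have -> : \sum_(i < N.*2) 2 * (Gfun slo shi (e i) * (q i.+1 - q i)) = c.
  rewrite (sum_double (fun i => 2 * (Gfun slo shi (e i) * (q i.+1 - q i)))).
  have G1 : Gfun slo shi 1 = shi ^+ 2 / 2.
    by rewrite /Gfun max_l// max_r ?lerN10//; lra.
  have GN1 : Gfun slo shi (-1) = - (slo ^+ 2 / 2).
    by rewrite /Gfun opprK max_r ?lerN10// max_l//; lra.
  transitivity (\sum_(j < N) (shi ^+ 2 - slo ^+ 2) / 2 * (p j.+1 - p j)).
    apply: eq_bigr => j _; rewrite /e alternating_even alternating_odd G1 GN1.
    by rewrite !midpoints_incr doubleK /= uphalf_double; field.
  rewrite -mulr_sumr -(big_mkord xpredT (fun j => p j.+1 - p j)).
  by rewrite telescope_sumr//; have [-> -> _] := Pp; rewrite /c; field.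
apply/negP; rewrite -ltNge.
have -> : incr_sum N.*2 e (fun i => QV (q i)) =
    incr_sum N.*2 e (fun i => I (q i) h).
  apply: eq_bigr => -[i iN] _ /=; rewrite !QVh//.
  - by rewrite (part_ge0 Pq) 1?ltnW// (part_le_end Pq)// ltnW.
  - by rewrite (part_ge0 Pq)// (part_le_end Pq).
apply: le_lt_trans h_eta.
have := incr_integral_lip T0 HE0 HI Pq e1 h Heta.
have etaE' : eta = step N p xi by [].
rewrite etaE'; have [_ ->] := incr_integral_embed T0 HI e Pq Pp Hxi.
have -> : (fun w => \sum_(j < N) xi j w * \sum_(i < N.*2) e i *
    (overlap (p j) (p j.+1) (q i.+1) - overlap (p j) (p j.+1) (q i))) =
    (0 : cpath T -> R^o).
  apply/funext => w; apply: big1 => -[j jN] _ /=.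
  by rewrite (overlap_midpoints Pp jN) mulr0.
rewrite (embed0 (H0_zero T0) L) subr0.
exact.
Qed.
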